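(* Let $t\geq 2$ and $m\geq 2$ be integers. Define \[F(x)=-x^2\cdot \tfrac{m^2+2m}{2}+x\cdot \tfrac{m^2t+mt+3m}{2}-mt,\qquad G(x)=-x^2\cdot \tfrac{m^2+2m}{2}+x\cdot \tfrac{m^2t+mt-m}{2},\] and let $a=\alpha_{m,t}(3)=\frac{mt+t+3}{2(m+2)}$ and $b=\alpha_{m,t}(-1)=\frac{mt+t-1}{2(m+2)}$. Set $a^*=\lfloor a\rfloor$ if $\{a\}\le 1/2$ and $a^*=\lfloor a\rfloor+1$ if $\{a\}>1/2$; similarly set $b^*=\lfloor b\rfloor$ if $\{b\}\le 1/2$ and $b^*=\lfloor b\rfloor+1$ if $\{b\}>1/2$. (1) If either $t$ is odd and $t>m+1$, or $t$ is even and $t>2m+3$, then the largest size of a $(t,mt-1)$-core partition with distinct parts is $\max(F(a^* ),G(b^* ))$. (2) If either $t$ is odd and $t\leq m+1$, or $t$ is even and $t\leq 2m+3$, then the largest size of a $(t,mt-1)$-core partition with distinct parts is $\max\left(F(a^* ),\,G\left(\lfloor \tfrac{t-1}{2}\rfloor\right)\right)$. (3) The number of $(t,mt-1)$-core partitions with distinct parts which have the largest size is at most $2$.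
   Context: A partition is a finite weakly decreasing sequence $\lambda=(\lambda_1,\ldots,\lambda_\ell)$ of positive integers; its size is $\sum_i\lambda_i$, and it has distinct parts if $\lambda_1>\lambda_2>\cdots>\lambda_\ell$. In the Young diagram of $\lambda$ (row $i$ has $\lambda_i$ left-justified boxes), the hook length of box $(i,j)$ is the number of boxes directly to its right, directly below it, plus the box itself. For a positive integer $s$, $\lambda$ is an $s$-core partition if no hook length is divisible by $s$; it is a $(t_1,t_2)$-core partition if it is both a $t_1$-core and a $t_2$-core. For $m,t\in\mathbb{N}$ and $x\in\mathbb{Z}$, $\alpha_{m,t}(x):=\frac{mt+t+x}{2(m+2)}$. $\lfloor x\rfloor$ is the largest integer not exceeding $x$ and $\{x\}=x-\lfloor x\rfloor$ is the fractional part; $\max(x,y)$ is the larger of $x,y$. *)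

(* Defs.v *)
From mathcomp Require Export all_boot all_order all_algebra.
From mathcomp Require Export archimedean.

Set Implicit Arguments.
Unset Strict Implicit.
Unset Printing Implicit Defensive.

Import Order.TTheory GRing.Theory Num.Theory.

(* Partitions are sequences of nat; their size is [sumn la], while [size la] is
   the number of parts.  The empty partition is included. *)
Definition is_partition (la : seq nat) : bool :=
  sorted geq la && all (fun k => 0 < k) la.

Definition distinct_parts (la : seq nat) : bool := sorted gtn la.

(* Rows and columns are numbered from 0: the boxes are the (i, j) with
   i < size la and j < nth 0 la i. *)
Definition in_diagram (la : seq nat) (i j : nat) : bool :=
  (i < size la) && (j < nth 0 la i).

Definition arm (la : seq nat) (i j : nat) : nat := nth 0 la i - j.+1.

(* A row below row i meets column j iff its length is larger than j. *)
Definition leg (la : seq nat) (i j : nat) : nat :=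
  count (fun k => j < k) (drop i.+1 la).

Definition hook_length (la : seq nat) (i j : nat) : nat :=
  arm la i j + leg la i j + 1.

Definition is_core (s : nat) (la : seq nat) : Prop :=
  is_partition la /\
  forall i j : nat, in_diagram la i j -> ~~ (s %| hook_length la i j).

Definition distinct_core2 (t1 t2 : nat) (la : seq nat) : Prop :=
  [/\ is_core t1 la, is_core t2 la & distinct_parts la].

Definition has_largest_size (P : seq nat -> Prop) (la : seq nat) : Prop :=
  P la /\ forall mu : seq nat, P mu -> sumn mu <= sumn la.

Definition largest_size_is (P : seq nat -> Prop) (v : rat) : Prop :=
  exists la : seq nat, has_largest_size P la /\ ((sumn la)%:R = v)%R.

(* [s] lists, without repetition, exactly the elements of P. *)
Definition card_at_most (P : seq nat -> Prop) (n : nat) : Prop :=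
  exists s : seq (seq nat),
    [/\ uniq s, forall la : seq nat, la \in s <-> P la & size s <= n].

Local Open Scope ring_scope.

Definition alpha (m t : nat) (x : int) : rat :=
  (m%:R * t%:R + t%:R + x%:~R) / (2 * (m%:R + 2)).

Definition frac_part (x : rat) : rat := x - (Num.floor x)%:~R.

(* Nearest integer, ties being rounded down: the star operation a |-> a^*. *)
Definition star (x : rat) : int :=
  if frac_part x <= 1 / 2 then Num.floor x else Num.floor x + 1.

Definition F (m t : nat) (x : rat) : rat :=
  - x ^+ 2 * ((m%:R ^+ 2 + 2 * m%:R) / 2)
  + x * ((m%:R ^+ 2 * t%:R + m%:R * t%:R + 3 * m%:R) / 2)
  - m%:R * t%:R.

Definition G (m t : nat) (x : rat) : rat :=
  - x ^+ 2 * ((m%:R ^+ 2 + 2 * m%:R) / 2)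
  + x * ((m%:R ^+ 2 * t%:R + m%:R * t%:R - m%:R) / 2).

(* Main.v *)
Require Import Defs.
From mathcomp Require Import all_boot all_order all_algebra archimedean.
From mathcomp Require Import zify ring lra.

(* The first-column hook lengths of a partition with distinct parts form a set
   of positive integers without two consecutive elements.  For a t-core this
   set is {i + q t : q < c i} for some counts c i on the residues 0 < i < t, and
   the (m t - 1)-core condition amounts to c i <= m and c (t - 1) <= m - 1.
   The size is a strictly convex function of each c i, so in a largest
   partition every c i is 0 or maximal; then the residues used must be
   {t-2, t-4, ...} (k of them, size G k) or {t-1, t-3, ...} (k of them,
   size F k).  Since F k - G k = m (2 k - t), the second family is
   dominated by the first unless k = t / 2, where F k = G k; so the largest size
   is the maximum of the strictly concave G over the integers
   0 <= k <= t / 2, reached at most twice. *)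

Set Implicit Arguments.
Unset Strict Implicit.
Unset Printing Implicit Defensive.

Import Order.TTheory GRing.Theory Num.Theory.

(** * Hook lengths and beta-sets *)

(** First-column hook lengths, top row first: a row of length [x] with [size l] rows below it has
    leftmost hook [x + size l]. *)
Fixpoint beta (la : seq nat) : seq nat :=
  if la is x :: l then (x + size l) :: beta l else [::].

Fixpoint unbeta (B : seq nat) : seq nat :=
  if B is b :: B' then (b - size B') :: unbeta B' else [::].

Definition gap2 : rel nat := fun x y => y.+1 < x.

(** The hook lengths in the row with first-column hook [x] are the differences [x - y] over the gaps
    [y < x] of the set. *)
Definition core_set (s : nat) (B : seq nat) : Prop :=
  forall x y, x \in B -> y < x -> y \notin B -> ~~ (s %| x - y).

Lemma size_beta la : size (beta la) = size la.
Proof. by elim: la => //= x l ->. Qed.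

Lemma betaK : cancel beta unbeta.
Proof. by elim=> //= x l ->; rewrite size_beta addnK. Qed.

Lemma size_unbeta B : size (unbeta B) = size B.
Proof. by elim: B => //= b B ->. Qed.

Lemma gap2_trans : transitive gap2.
Proof. by move=> y x z; rewrite /gap2; lia. Qed.

Lemma gap2_gtn x y : gap2 x y -> gtn x y.
Proof. by rewrite /gap2 /=; lia. Qed.

(** This bound makes the truncated subtraction in [unbeta] exact. *)
Lemma sorted_gap2_size b B : path gap2 b B -> size B <= b.
Proof.
elim: B b => //= x B IH b /andP[h /IH].
by rewrite /gap2 in h; lia.
Qed.

Lemma unbetaK B : sorted gap2 B -> beta (unbeta B) = B.
Proof.
elim: B => //= b B IH p.
rewrite IH ?(path_sorted p) // size_unbeta subnK //.
exact: sorted_gap2_size p.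
Qed.

Lemma sorted_beta la : sorted gap2 (beta la) = sorted gtn la.
Proof.
elim: la => //= x [|y l] //= <-; congr (_ && _).
by rewrite /gap2 /=; lia.
Qed.

Lemma beta_pos la : sorted gtn la ->
  all (fun k => 0 < k) (beta la) = all (fun k => 0 < k) la.
Proof.
elim: la => //= x l IH p; rewrite IH ?(path_sorted p) //.
case: l p {IH} => [|y l] /= p; first by rewrite addn0.
by case/andP: p => yx _; have -> : 0 < x by [lia]; rewrite addnS.
Qed.

Lemma sumn_beta la :
  2 * sumn (beta la) = 2 * sumn la + size la * (size la).-1.
Proof. by elim: la => //= x [|y l] //=; nia. Qed.

(** Number the steps of the boundary of the diagram from the bottom left: vertical steps carry the
    elements of [beta l], horizontal ones the gaps. The step of column [j] comes after [j]
    horizontal steps and one vertical step for each part at most [j]. *)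
Lemma notin_betaP l y : sorted geq l ->
  (y \notin beta l) <-> exists j, y = j + count (fun k => k <= j) l.
Proof.
elim: l y => [|z l IH] y.
  by move=> _; split=> // _; exists y; rewrite /= addn0.
rewrite /= => p; have s := path_sorted p.
have zl : all (geq z) l.
  by apply: (order_path_min _ p) => a b c /=; lia.
have cz j : z <= j -> count (fun k => k <= j) l = size l.
  move=> zj; apply/eqP; rewrite -all_count; apply/allP => w /(allP zl) /=.
  by lia.
rewrite inE negb_or; split.
(* From column [z] on, the new row counts as one more short part, so the column index drops by
   one. *)
- case/andP=> ny /(IH _ s)[j ej]; exists (if j < z then j else j.-1).
  case: (ltnP j z) => jz; first by rewrite leqNgt jz.
  rewrite cz // in ej.
  have {}jz : z < j by rewrite ltn_neqAle jz andbT; apply: contra ny => /eqP ->; lia.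
  by rewrite cz; lia.
- case=> j ej; apply/andP; case: (leqP z j) ej => zj ej.
    split; first by rewrite cz // in ej; lia.
    by apply/(IH _ s); exists j.+1; rewrite ej !cz; lia.
  split; last by apply/(IH _ s); exists j; rewrite ej.
  by have := count_size (fun k => k <= j) l; lia.
Qed.

Lemma beta_lt x l : path geq x l -> forall y, y \in beta l -> y < x + size l.
Proof.
elim: l x => //= z l IH x /andP[/= zx p] y; rewrite inE => /orP[/eqP->|/(IH z p)]; lia.
Qed.

(** Induction on rows: by [hk] the hook of the first row in column [j] is the first beta number
    minus the gap of column [j], and the columns [j < x] give exactly the gaps below that number. *)
Lemma hook_coreP s la : sorted geq la ->
  (forall i j, in_diagram la i j -> ~~ (s %| hook_length la i j)) <->
  core_set s (beta la).
Proof.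
elim: la => [|x l IH]; first by split.
rewrite /= => p; have sl := path_sorted p; have {}IH := IH sl.
have xl : all (geq x) l by apply: (order_path_min _ p) => a b c /=; lia.
have hk j : j < x -> hook_length (x :: l) 0 j =
    x + size l - (j + count (fun k => k <= j) l).
  move=> jx; rewrite /hook_length /arm /leg /= drop0.
  have := count_predC (fun k => k <= j) l.
  rewrite (@eq_count _ (predC _) (fun k => j < k)) => [|k /=]; lia.
have bl := beta_lt p.
split.
- move=> h a b; rewrite !inE negb_or => /orP[/eqP-> {a}|al] ba /andP[nb bnl].
    have /(notin_betaP _ sl)[j ej] := bnl.
    have jx : j < x.
      rewrite ltnNge; apply/negP => xj; move: ba; rewrite ej.
      have /eqP -> : count (fun k => k <= j) l == size l.
        by rewrite -all_count; apply/allP => w /(allP xl) /=; lia.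
      by lia.
    by rewrite ej -hk //; apply: h.
  have /IH : forall i j, in_diagram l i j -> ~~ (s %| hook_length l i j).
    by move=> i j; apply: (h i.+1 j).
  exact.
- move=> h [|i] j.
    move=> /andP[_ /= jx]; rewrite hk //.
    have bn : j + count (fun k => k <= j) l \notin beta l.
      by apply/(notin_betaP _ sl); exists j.
    apply: h; rewrite ?inE ?eqxx //; have := count_size (fun k => k <= j) l.
      by lia.
    by move=> ?; rewrite negb_or bn andbT; lia.
  move: i j; apply/IH => a b al ba bn.
  apply: h => //; rewrite inE ?al ?orbT //.
  by rewrite negb_or bn andbT; have := bl _ al; lia.
Qed.

Lemma sorted_gtn_geq la : sorted gtn la -> sorted geq la.
Proof. by apply: sub_sorted => x y /=; lia. Qed.

Lemma distinct_core2_beta t1 t2 la :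
  distinct_core2 t1 t2 la <->
  [/\ sorted gap2 (beta la), all (fun k => 0 < k) (beta la),
      core_set t1 (beta la) & core_set t2 (beta la)].
Proof.
rewrite /distinct_core2 /is_core /is_partition /distinct_parts sorted_beta.
split.
- case=> [[/andP[sg po] h1] [_ h2] sd].
  by split=> //; rewrite ?beta_pos //; apply/hook_coreP.
- case=> sd po h1 h2; have sg := sorted_gtn_geq sd; rewrite beta_pos // in po.
  by rewrite sg po; do !split=> //; apply/hook_coreP.
Qed.

Lemma sorted_gap2P B : sorted gtn B ->
  (forall x, x \in B -> x.+1 \notin B) <-> sorted gap2 B.
Proof.
move=> sB; split; last first.
  rewrite sorted_pairwise; last exact: gap2_trans.
  elim: B {sB} => //= b B IH /andP[/allP bB /IH {}IH] x.
  rewrite !inE negb_or => /orP[/eqP->|xB].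
    by apply/andP; split; [lia|apply/negP => /bB; rewrite /gap2; lia].
  by rewrite IH // andbT; have := bB _ xB; rewrite /gap2; lia.
elim: B sB => //= b [|z B] //= IH /andP[zb p] h.
rewrite IH ?andbT //; last first.
  by move=> x xB; have := h x; rewrite !inE negb_or in xB * => /(_ _)/andP[]; rewrite ?xB ?orbT.
have := h z; rewrite !inE eqxx orbT => /(_ isT); rewrite negb_or /gap2 => /andP[? _].
by lia.
Qed.

(** * Cores as bead counts *)

(** Here [c i] counts the beads on the runner of residue [i]. Runner 0 is empty because 0 is not a
    hook length; runner t - 1 misses its m-th bead, which is m t - 1; adjacent nonempty runners
    would contain the consecutive numbers i and i + 1. *)
Definition admissible (t m : nat) (c : nat -> nat) : Prop :=
  [/\ c 0 = 0, c t.-1 < m, forall i, i < t -> c i <= m &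
      forall i, i.+1 < t -> c i = 0 \/ c i.+1 = 0].

Definition runner_set (t m : nat) (c : nat -> nat) : seq nat :=
  [seq x <- rev (iota 0 (m * t)) | x %/ t < c (x %% t)].

Definition abacus (t m : nat) (c : nat -> nat) : seq nat :=
  unbeta (runner_set t m c).

Section Abacus.
Variables (t m : nat).
Hypotheses (ht : 2 <= t) (hm : 2 <= m).
Let P := distinct_core2 t (m * t - 1).

Lemma runner_set_sorted c : sorted gtn (runner_set t m c).
Proof.
apply: sorted_filter; first by move=> a b d /=; lia.
by rewrite rev_sorted iota_ltn_sorted.
Qed.

Lemma mem_runner_set c x : (forall i, i < t -> c i <= m) ->
  (x \in runner_set t m c) = (x %/ t < c (x %% t)).
Proof.
move=> hc; rewrite mem_filter mem_rev mem_iota /= add0n.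
case: ltnP => //= h; rewrite -ltn_divLR; last by lia.
by apply: leq_trans h _; apply: hc; rewrite ltn_mod; lia.
Qed.

Lemma mulDmod q r : r < t -> (q * t + r) %/ t = q /\ (q * t + r) %% t = r.
Proof.
by move=> rt; rewrite divnMDl ?modnMDl ?modn_small ?divn_small ?addn0 //; lia.
Qed.

Lemma runner_set_gap2 c : admissible t m c -> sorted gap2 (runner_set t m c).
Proof.
move=> [c0 ct cm cc]; apply/sorted_gap2P; first exact: runner_set_sorted.
move=> x; rewrite !mem_runner_set //.
have rt : x %% t < t by rewrite ltn_mod; lia.
have ex := divn_eq x t.
case: (ltnP (x %% t).+1 t) => h.
  have [d e] := mulDmod (x %/ t) h.
  have -> : x.+1 = x %/ t * t + (x %% t).+1 by lia.
  by rewrite d e; case: (cc _ h) => ->; rewrite ltn0.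
(* Residue t - 1 is followed by residue 0, whose runner is empty. *)
have -> : x.+1 = (x %/ t).+1 * t + 0 by rewrite {1}ex; lia.
have [-> ->] : _ := @mulDmod (x %/ t).+1 0 (ltnW ht).
by rewrite c0.
Qed.

Lemma beta_abacus c : admissible t m c -> beta (abacus t m c) = runner_set t m c.
Proof. by move=> /runner_set_gap2; exact: unbetaK. Qed.

Lemma abacus_distinct_core c : admissible t m c -> P (abacus t m c).
Proof.
move=> ac; have [c0 ct cm cc] := ac.
apply/distinct_core2_beta; rewrite beta_abacus //; split.
- exact: runner_set_gap2.
- apply/allP => x; rewrite mem_runner_set //; case: x => //.
  by rewrite mod0n c0.
- move=> x y; rewrite !mem_runner_set // => hx yx; apply: contra => d.
  have -> : y %% t = x %% t by apply/eqP; rewrite eq_sym eqn_mod_dvd // ltnW.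
  by apply: leq_ltn_trans hx; apply: leq_div2r; lia.
(* All elements are below m t, so a difference of at least m t - 1 forces x = m t - 1, the bead
   forbidden on runner t - 1. *)
- move=> x y xB yx yB; apply/negP => /dvdn_leq; rewrite subn_gt0 => /(_ yx) h.
  have xm : x < m * t by move: xB; rewrite mem_filter mem_rev mem_iota => /andP[].
  have ex : x = m.-1 * t + t.-1 by nia.
  move: xB; rewrite mem_runner_set // ex.
  have [|-> ->] := @mulDmod m.-1 t.-1; lia.
Qed.

(* The (m t - 1)-core condition would force x - m t + 1 into the set next to
   x - m t, so every runner carries at most m beads. *)
Lemma distinct_core_abacus la : P la ->
  exists2 c, admissible t m c & la = abacus t m c.
Proof.
move=> /distinct_core2_beta[sg po ct cmt].
set B := beta la in sg po ct cmt.
have sB : sorted gtn B by apply: sub_sorted sg; exact: gap2_gtn.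
have gp := (sorted_gap2P sB).2 sg.
have n0 : 0 \notin B by apply/negP => /(allP po).
have down q r k : q * t + r \in B -> k <= q -> k * t + r \in B.
  move=> qB; rewrite leq_eqVlt => /orP[/eqP->//|kq].
  have lt : k * t + r < q * t + r by nia.
  case: (boolP (k * t + r \in B)) => // /(ct _ _ qB lt).
  by rewrite subnDr -mulnBl dvdn_mull.
have nb r : m * t + r \notin B.
  apply/negP => h.
  have h0 : r \in B by have := @down m r 0 h; rewrite mul0n; apply.
  case: (boolP (r.+1 \in B)) => [h1|h1]; first by have := gp _ h0; rewrite h1.
  have : r.+1 < m * t + r by nia.
  move/(cmt _ _ h)/(_ h1); have -> : m * t + r - r.+1 = m * t - 1 by nia.
  by rewrite dvdnn.
(* This number is m t - 1, at distance m t - 1 from the gap 0. *)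
have ntop : m.-1 * t + t.-1 \notin B.
  apply/negP => h; have : 0 < m.-1 * t + t.-1 by nia.
  move/(cmt _ _ h)/(_ n0); have -> : m.-1 * t + t.-1 - 0 = m * t - 1 by nia.
  by rewrite dvdnn.
(* The first missing level of the runner. [find] returns [m] when the first m beads are all present,
   and by [nb] that is then the full count. *)
pose c r := find (fun k => k * t + r \notin B) (iota 0 m).
have cm r : c r <= m by rewrite /c -[X in _ <= X](size_iota 0 m) find_size.
have cP k r : (k < c r) = (k * t + r \in B).
  case: ltnP => h; symmetry.
    have := before_find 0 h; rewrite nth_iota ?add0n => [/negbT|].
      by rewrite negbK.
    exact: leq_trans h (cm r).
  apply/negP => kB; have crB := down _ _ _ kB h.
  move: (cm r); rewrite leq_eqVlt => /orP[/eqP e|lt].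
    by have := nb r; rewrite -e crB.
  have := @nth_find _ 0 (fun k => k * t + r \notin B) (iota 0 m).
  rewrite has_find size_iota => /(_ lt).
  by rewrite nth_iota // add0n crB.
exists c.
  split=> //.
  - apply/eqP; rewrite -leqn0 leqNgt cP; exact: n0.
  - have := cP m.-1 t.-1; rewrite (negbTE ntop); lia.
  - move=> i it; case: (posnP (c i)) => [->|]; first by left.
    rewrite cP mul0n add0n => /gp h; right; apply/eqP.
    by rewrite -leqn0 leqNgt cP.
rewrite -[la]betaK /abacus; congr unbeta.
apply: (@irr_sorted_eq _ gtn) => //; try by move=> * /=; lia.
  exact: runner_set_sorted.
by move=> x; rewrite mem_runner_set // cP -divn_eq.
Qed.

Lemma big_nat_divmod (f : nat -> nat) n :
  \sum_(0 <= x < n * t) f x = \sum_(0 <= q < n) \sum_(0 <= r < t) f (q * t + r).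
Proof.
elim: n => [|n IH]; first by rewrite mul0n !big_geq.
rewrite big_nat_recr //= -IH (@big_cat_nat _ _ _ (n * t)) //=; last by nia.
congr (_ + _).
by rewrite -{1}[n * t]add0n big_addn mulSn addnK; apply: eq_bigr => r _; rewrite addnC.
Qed.

Lemma big_runner_set (f : nat -> nat) c : (forall i, i < t -> c i <= m) ->
  \sum_(x <- runner_set t m c) f x =
  \sum_(i < t) \sum_(0 <= q < c i) f (q * t + i).
Proof.
move=> cm; rewrite big_filter (perm_big (iota 0 (m * t))) ?perm_rev //=.
have -> : iota 0 (m * t) = index_iota 0 (m * t) by rewrite /index_iota subn0.
rewrite big_mkcond big_nat_divmod exchange_big /= big_mkord; apply: eq_bigr => i _.
rewrite (@big_nat_widen _ _ _ 0 (c i) m) ?cm //=.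
rewrite [RHS]big_mkcond /=; apply: eq_bigr => q _.
by have [-> ->] := mulDmod q (ltn_ord i).
Qed.

Lemma sum_progression i n :
  2 * (\sum_(0 <= q < n) (q * t + i)) = 2 * i * n + t * (n * n.-1).
Proof.
elim: n => [|[|n] IH]; first by rewrite big_geq ?muln0.
  by rewrite big_nat1; lia.
by rewrite big_nat_recr //= mulnDr IH; nia.
Qed.

Local Open Scope ring_scope.

(* Twice the size of [abacus t m c], see [sumn_abacus]. *)
Definition weight2 (c : nat -> nat) : int :=
  \sum_(i < t) (2 * i%:Z * (c i)%:Z + t%:Z * ((c i)%:Z * ((c i)%:Z - 1)))
  - (\sum_(i < t) (c i)%:Z) * (\sum_(i < t) (c i)%:Z - 1).

Lemma mul_pred n : (n * n.-1)%N%:Z = n%:Z * (n%:Z - 1).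
Proof. by case: n => [|n] //=; lia. Qed.

(** Each runner contributes an arithmetic progression; the product subtracted in [weight2] is the
    staircase term n (n - 1) of [sumn_beta], with n the number of parts. *)
Lemma sumn_abacus c : admissible t m c ->
  2 * (sumn (abacus t m c))%:Z = weight2 c.
Proof.
move=> ac; have [_ _ cm _] := ac.
have := sumn_beta (abacus t m c).
rewrite -[size (abacus _ _ _)]size_beta beta_abacus // sumnE big_runner_set //.
rewrite -sum1_size big_runner_set // big_distrr /=.
set n := (\sum_(i < t) \sum_(0 <= q < c i) 1)%N.
have en : n%:Z = \sum_(i < t) (c i)%:Z.
  rewrite /n (raddf_sum Posz) /=; apply: eq_bigr => i _.
  by rewrite sum_nat_const_nat subn0 muln1.
move/(congr1 Posz); rewrite PoszD mul_pred en (raddf_sum Posz) /weight2.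
move=> e; apply/eqP; rewrite eq_sym subr_eq PoszM in e *.
rewrite -e; apply/eqP/eq_bigr => i _.
by rewrite -mul_pred -!PoszM -PoszD -sum_progression.
Qed.

End Abacus.

(** * Extremal configurations *)

Lemma abacus_ext t m c c' : 0 < t -> (forall i, i < t -> c i = c' i) ->
  abacus t m c = abacus t m c'.
Proof.
move=> t0 e; congr unbeta; apply: eq_filter => x /=.
by rewrite e // ltn_mod.
Qed.

(** For 2 k <= N this is the indicator of {N-1, N-3, ..., N-2k+1}. *)
Definition top_pattern (N k i : nat) : bool := (N <= i + 2 * k) && odd (N - i).

Lemma top_patternSS N k i : i < N ->
  top_pattern N.+2 k.+1 i = top_pattern N k i.
Proof.
move=> iN; rewrite /top_pattern; congr (_ && _); first by lia.
by rewrite subSn ?subSn //= ?negbK // ltnW // ltnW.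
Qed.

Lemma top_pattern_sums N k : 2 * k <= N ->
  \sum_(i < N) (top_pattern N k i : nat) = k /\
  \sum_(i < N) top_pattern N k i * i + k * k = k * N.
Proof.
elim: k N => [|k IH] N hN.
  by rewrite !big1 // => i _; rewrite /top_pattern leqNgt addn0 ltn_ord.
case: N hN => [|[|N]] hN; try by lia.
have [e1 e2] : _ := IH N ltac:(lia).
rewrite !big_ord_recr /=.
under eq_bigr => i _ do rewrite top_patternSS //.
rewrite e1; under eq_bigr => i _ do rewrite top_patternSS //.
have -> : top_pattern N.+2 k.+1 N = false.
  by rewrite /top_pattern -[N.+2]addn2 addKn andbF.
have -> : top_pattern N.+2 k.+1 N.+1 = true.
  by rewrite /top_pattern -[N.+2]addn1 addKn andbT; lia.
by move: e2; set S := \sum_(i < N) _; rewrite /=; nia.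
Qed.

Definition isolated (s : nat -> bool) (N : nat) : Prop :=
  s 0 = false /\ forall i, i.+1 < N -> ~~ (s i && s i.+1).

Lemma isolated_leq s M N : M <= N -> isolated s N -> isolated s M.
Proof. by move=> MN [s0 h]; split=> // i iM; apply: h; lia. Qed.

(* k N - k^2 is the sum of the k numbers N-1, N-3, ..., N-2k+1. *)
Lemma isolated_sum_max (s : nat -> bool) N (k := \sum_(i < N) (s i : nat))
    (S := \sum_(i < N) s i * i) : isolated s N ->
  [/\ 2 * k <= N, S + k * k <= k * N &
      S + k * k = k * N -> forall i, i < N -> s i = top_pattern N k i].
Proof.
rewrite {}/k {}/S.
elim/ltn_ind: N => -[|[|N]] IH iso.
- by rewrite !big_ord0.
- case: iso => s0 _; rewrite !big_ord_recr !big_ord0 /= s0; split=> // _ [|i] //.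
(* If the last position is used, its neighbour is not; dropping both lowers k by one. *)
case sN1 : (s N.+1).
  have sN : s N = false.
    by apply/negP => sN; have := iso.2 N (ltnSn _); rewrite sN sN1.
  have [|h1 h2 h3] := IH N ltac:(lia); first by apply: isolated_leq iso; lia.
  rewrite !big_ord_recr /= sN sN1 mul0n mul1n !addn0.
  move: h1 h2 h3; set k := \sum_(i < N) (s i : nat); set S := \sum_(i < N) _.
  move=> h1 h2 h3; split; [lia|nia|].
  rewrite addn1 => e i iN.
  have {}h3 := h3 ltac:(nia).
  case: (ltnP i N) => lN; first by rewrite top_patternSS // h3.
  have [->|->] : i = N \/ i = N.+1 by lia.
    by rewrite sN /top_pattern -[N.+2]addn2 addKn andbF.
  by rewrite sN1 /top_pattern -[N.+2]addn1 addKn andbT; lia.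
have [|h1 h2 h3] := IH N.+1 ltac:(lia); first by apply: isolated_leq iso; lia.
rewrite big_ord_recr [X in X + _]big_ord_recr /= sN1 mul0n !addn0.
move: h1 h2 h3; set k := \sum_(i < N.+1) (s i : nat).
set S := \sum_(i < N.+1) _ => h1 h2 h3; split; [lia|nia|].
move=> e; have k0 : k = 0 by nia.
rewrite k0 in h2 h3 *; move=> i iN.
case: (ltnP i N.+1) => lN; first by rewrite h3 /top_pattern //; lia.
have -> : i = N.+1 by lia.
by rewrite sN1 /top_pattern; lia.
Qed.

Local Open Scope ring_scope.

(** * Convexity in a single bead count *)

Definition upd (c : nat -> nat) (i x : nat) : nat -> nat :=
  fun j => if j == i then x else c j.

Lemma weight2_ext t c c' : (forall i, (i < t)%N -> c i = c' i) ->
  weight2 t c = weight2 t c'.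
Proof.
move=> e; rewrite /weight2.
have -> : \sum_(i < t) (c i)%:Z = \sum_(i < t) (c' i)%:Z.
  by apply: eq_bigr => i _; rewrite e.
by congr (_ - _); apply: eq_bigr => i _; rewrite e.
Qed.

(** The leading coefficient is t from the runner itself minus 1 from the square of the total count;
    only its positivity matters later, so [K] and [L] stay existential. *)
Lemma weight2_upd t c i : (i < t)%N -> exists K L : int,
  forall x, weight2 t (upd c i x) = (t%:Z - 1) * x%:Z ^+ 2 + K * x%:Z + L.
Proof.
move=> it; pose o := Ordinal it.
pose n := \sum_(j < t | j != o) (c j)%:Z.
pose W := \sum_(j < t | j != o)
  (2 * j%:Z * (c j)%:Z + t%:Z * ((c j)%:Z * ((c j)%:Z - 1))).
exists (2 * i%:Z - t%:Z - 2 * n + 1), (W - n * (n - 1)) => x.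
have cj j : j != o -> upd c i x j = c j.
  by move=> jo; rewrite /upd ifN //; apply: contra jo => /eqP e; apply/eqP/val_inj.
rewrite /weight2 (bigD1 o) //= [\sum_(i0 < t) _](bigD1 o) //=.
under eq_bigr => j jo do rewrite cj //.
under [X in _ - (_ + X) * _]eq_bigr => j jo do rewrite cj //.
under [X in _ - _ * (_ + X - _)]eq_bigr => j jo do rewrite cj //.
rewrite -/n -/W /upd eqxx; ring.
Qed.

Lemma weight2_convex t c i M : (1 < t)%N -> (i < t)%N -> (0 < c i < M)%N ->
  weight2 t c < weight2 t (upd c i 0) \/ weight2 t c < weight2 t (upd c i M).
Proof.
move=> t1 it /andP[c0 cM]; have [K [L h]] := weight2_upd c it.
have -> : weight2 t c = weight2 t (upd c i (c i)).
  by apply: weight2_ext => j _; rewrite /upd; case: eqP => // ->.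
rewrite !h; move: (c i) c0 cM => x x0 xM {h}.
(* [u] is the slope of the chord from 0 to [x]: if it is negative, 0 is better; otherwise the chord
   from [x] to [M] has the positive slope u + (t - 1) M. *)
pose u := (t%:Z - 1) * x%:Z + K; have [u0|u0] := ltrP u 0; [left|right].
  rewrite -subr_gt0; have -> : (t%:Z - 1) * 0%N%:Z ^+ 2 + K * 0%N%:Z + L -
    ((t%:Z - 1) * x%:Z ^+ 2 + K * x%:Z + L) = x%:Z * - u by rewrite /u; ring.
  by rewrite pmulr_rgt0 ?oppr_gt0.
rewrite -subr_gt0; have -> : (t%:Z - 1) * M%:Z ^+ 2 + K * M%:Z + L -
    ((t%:Z - 1) * x%:Z ^+ 2 + K * x%:Z + L) =
    (M%:Z - x%:Z) * (u + (t%:Z - 1) * M%:Z) by rewrite /u; ring.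
rewrite pmulr_rgt0; last by lia.
by rewrite ltr_wpDl // pmulr_rgt0; lia.
Qed.

Definition runner_top (t m i : nat) : nat := if i == t.-1 then m.-1 else m.

Lemma admissible_upd t m c i x : (0 < m)%N -> (0 < i < t)%N -> (0 < c i)%N ->
  (x <= runner_top t m i)%N -> admissible t m c -> admissible t m (upd c i x).
Proof.
rewrite /runner_top => m0 it ci xi [c0 ct cm cc]; split; rewrite /upd.
- by case: eqP => // e; lia.
- by case: eqP => // e; rewrite -e eqxx in xi; lia.
- by move=> j jt; case: eqP => e; [case: ifP xi; lia | exact: cm].
- move=> j jt; have := cc j jt.
  by case: eqP => [->|_]; case: eqP => [->|_] h; auto; case: h; lia.
Qed.

(** Runners are pushed to an extreme one at a time. Only nonempty runners are changed, so their
    neighbours are already empty and admissibility survives. The gain is strict unless nothing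
    changed, as counting the maximizers requires. *)
Lemma extremal_improve t m c : (1 < t)%N -> (1 < m)%N -> admissible t m c ->
  forall n, (n <= t)%N -> exists c', [/\ admissible t m c',
    forall i, (i < n)%N -> c' i = 0%N \/ c' i = runner_top t m i &
    c' = c \/ weight2 t c < weight2 t c'].
Proof.
move=> t1 m1 ac; elim=> [|n IH] nt; first by exists c; split=> //; left.
have [|c1 [a1 x1 w1]] := IH; first by lia.
have [c10 ct cm cc] := a1.
have ctop : (c1 n <= runner_top t m n)%N.
  by rewrite /runner_top; case: eqP => [->|_]; [lia|exact: cm].
have [e|c1n] := posnP (c1 n).
  exists c1; split=> // i; rewrite ltnS leq_eqVlt => /orP[/eqP->|/x1//]; by left.
have [e|ne] := eqVneq (c1 n) (runner_top t m n).
  exists c1; split=> // i; rewrite ltnS leq_eqVlt => /orP[/eqP->|/x1//]; by right.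
have n0 : (0 < n < t)%N by rewrite nt andbT lt0n; apply/eqP => e; rewrite e c10 in c1n.
have good x : x = 0%N \/ x = runner_top t m n -> weight2 t c1 < weight2 t (upd c1 n x) ->
    exists c', [/\ admissible t m c',
    forall i, (i < n.+1)%N -> c' i = 0%N \/ c' i = runner_top t m i &
    c' = c \/ weight2 t c < weight2 t c'].
  move=> hx w; exists (upd c1 n x); split.
  - apply: admissible_upd => //; first by lia.
    by case: hx => ->.
  - move=> i; rewrite ltnS leq_eqVlt /upd; case: eqP => [-> //|_] /=; exact: x1.
  - by right; case: w1 => [<- //|]; move/lt_trans; apply.
have [|w|w] := @weight2_convex t c1 n (runner_top t m n) t1 nt; first by lia.
- by apply: good w; left.
- by apply: good w; right.
Qed.

(** * The two extremal families and their sizes *)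

Definition conf_G (t m k i : nat) : nat :=
  if (i < t.-1)%N && top_pattern t.-1 k i then m else 0.

(** Runner t - 1 is one of the k runners in use, which leaves [k.-1] for the pattern t - 3, t - 5,
    ... *)
Definition conf_F (t m k i : nat) : nat :=
  if i == t.-1 then m.-1
  else if (i < t.-2)%N && top_pattern t.-2 k.-1 i then m else 0.

(** [G2] and [F2] are twice [G] and [F], with integer values. *)
Definition G2 (t m : nat) (k : int) : int :=
  - k ^+ 2 * (m%:Z ^+ 2 + 2 * m%:Z)
  + k * (m%:Z ^+ 2 * t%:Z + m%:Z * t%:Z - m%:Z).

Definition F2 (t m : nat) (k : int) : int :=
  - k ^+ 2 * (m%:Z ^+ 2 + 2 * m%:Z)
  + k * (m%:Z ^+ 2 * t%:Z + m%:Z * t%:Z + 3 * m%:Z) - 2 * m%:Z * t%:Z.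

Lemma weight_parts t m N (c : nat -> nat) (s : nat -> bool) :
  (forall i, (i < N)%N -> c i = if s i then m else 0%N) ->
  \sum_(i < N) (2 * i%:Z * (c i)%:Z + t%:Z * ((c i)%:Z * ((c i)%:Z - 1))) =
    2 * m%:Z * (\sum_(i < N) s i * i)%N%:Z
    + t%:Z * (m%:Z * (m%:Z - 1)) * (\sum_(i < N) (s i : nat))%N%:Z /\
  \sum_(i < N) (c i)%:Z = m%:Z * (\sum_(i < N) (s i : nat))%N%:Z.
Proof.
elim: N => [|N IH] h; first by rewrite !big_ord0; split; lia.
have [|e1 e2] := IH; first by move=> i iN; apply: h; lia.
rewrite !big_ord_recr /= e1 e2 !PoszD PoszM h //.
by case: (s N) => /=; split; ring.
Qed.

(** The last term is the defect bounded by [isolated_sum_max]: never positive for an isolated set,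
    and zero only for the top pattern. *)
Lemma weight2_noend t m c (s : nat -> bool) (N := t.-1)
    (k := (\sum_(i < N) (s i : nat))%N) (S := (\sum_(i < N) s i * i)%N) :
  (0 < t)%N -> (forall i, (i < N)%N -> c i = if s i then m else 0%N) ->
  c N = 0%N ->
  weight2 t c = G2 t m k%:Z + 2 * m%:Z * (S%:Z + k%:Z * k%:Z - k%:Z * N%:Z).
Proof.
rewrite {}/k {}/S {}/N; case: t => // N _ /= h cN.
have [e1 e2] := weight_parts N.+1 h.
rewrite /weight2 !big_ord_recr /= e1 e2 cN /G2; ring.
Qed.

Lemma weight2_end t m c (s : nat -> bool) (N := t.-2)
    (k := (\sum_(i < N) (s i : nat))%N) (S := (\sum_(i < N) s i * i)%N) :
  (1 < t)%N -> (0 < m)%N ->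
  (forall i, (i < N)%N -> c i = if s i then m else 0%N) ->
  c N = 0%N -> c N.+1 = m.-1 ->
  weight2 t c = F2 t m (k%:Z + 1) + 2 * m%:Z * (S%:Z + k%:Z * k%:Z - k%:Z * N%:Z).
Proof.
rewrite {}/k {}/S {}/N; case: t => // -[|N] // _ /=; case: m => // m _ h cN cN1.
have [e1 e2] := weight_parts N.+2 h.
rewrite /weight2 !big_ord_recr /= e1 e2 cN cN1 /F2 /=; ring.
Qed.

Lemma weight2_conf_G t m k : (0 < t)%N -> (2 * k < t)%N ->
  weight2 t (conf_G t m k) = G2 t m k%:Z.
Proof.
move=> t0 kt; have [|e1 e2] := @top_pattern_sums t.-1 k; first by lia.
rewrite (@weight2_noend t m _ (top_pattern t.-1 k)) //.
- by rewrite e1; move: e2; set S := (\sum_(i < _) _)%N; nia.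
- by move=> i it; rewrite /conf_G it.
- by rewrite /conf_G ltnn.
Qed.

Lemma weight2_conf_F t m k : (1 < t)%N -> (0 < m)%N -> (0 < k)%N -> (2 * k <= t)%N ->
  weight2 t (conf_F t m k) = F2 t m k%:Z.
Proof.
move=> t0 m0 k0 kt; have [|e1 e2] := @top_pattern_sums t.-2 k.-1; first by lia.
rewrite (@weight2_end t m _ (top_pattern t.-2 k.-1)) //.
- rewrite e1; have -> : k.-1%:Z + 1 = k%:Z by lia.
  by move: e2; set S := (\sum_(i < _) _)%N; nia.
- by move=> i it; rewrite /conf_F it ifN //; lia.
- by rewrite /conf_F ltnn ifN //; lia.
- by rewrite /conf_F ifT //; lia.
Qed.

Lemma top_pattern_isolated N k i : (i.+1 < N)%N ->
  ~~ (top_pattern N k i && top_pattern N k i.+1).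
Proof.
move=> iN; rewrite /top_pattern; have -> : (N - i = (N - i.+1).+1)%N by lia.
by rewrite /=; case: odd; rewrite !(andbF, andbT).
Qed.

Lemma admissible_conf_G t m k : (1 < t)%N -> (0 < m)%N -> (2 * k < t)%N ->
  admissible t m (conf_G t m k).
Proof.
move=> t1 m0 kt; rewrite /conf_G; split.
- rewrite ifN // negb_and; apply/orP; right; rewrite /top_pattern add0n subn0.
  by apply/negP => /andP[h]; have -> : t.-1 = (2 * k)%N by [lia]; rewrite mul2n odd_double.
- by rewrite ltnn.
- by move=> i _; case: ifP.
- move=> i it; case: (ltnP i.+1 t.-1) => h; last by right.
  have := @top_pattern_isolated t.-1 k i h.
  by rewrite negb_and => /orP[] /negbTE ->; rewrite andbF; auto.
Qed.

Lemma admissible_conf_F t m k : (1 < t)%N -> (0 < m)%N -> (0 < k)%N ->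
  (2 * k <= t)%N -> admissible t m (conf_F t m k).
Proof.
move=> t1 m0 k0 kt; rewrite /conf_F; split.
- rewrite ifN; last by lia.
  rewrite ifN // negb_and; apply/orP; right; rewrite /top_pattern add0n subn0.
  apply/negP => /andP[h]; have -> : t.-2 = (2 * k.-1)%N by lia.
  by rewrite mul2n odd_double.
- by rewrite eqxx; lia.
- by move=> i _; case: ifP => _; [lia|case: ifP].
- move=> i it; rewrite ifN; last by lia.
  case: (ltnP i t.-2) => h /=; last by left.
  have -> : (i.+1 == t.-1) = false by lia.
  case: (ltnP i.+1 t.-2) => h' /=; last by right.
  have := @top_pattern_isolated t.-2 k.-1 i h'.
  by rewrite negb_and => /orP[] /negbTE ->; auto.
Qed.

(** The two alternatives correspond to runner t - 1 being empty or holding m - 1 beads; in each, a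
    nonzero defect makes the weight strictly smaller. *)
Lemma extremal_weight t m c : (1 < t)%N -> (1 < m)%N -> admissible t m c ->
  (forall i, (i < t)%N -> c i = 0%N \/ c i = runner_top t m i) ->
  (exists2 k, (2 * k < t)%N & weight2 t c < G2 t m k%:Z \/
      forall i, (i < t)%N -> c i = conf_G t m k i) \/
  (exists2 k, (0 < k)%N && (2 * k <= t)%N & weight2 t c < F2 t m k%:Z \/
      forall i, (i < t)%N -> c i = conf_F t m k i).
Proof.
move=> t1 m1 [c0 ct cm cc] ext.
pose s i := (0 < c i)%N.
have iso : isolated s t.
  split=> [|i it]; first by rewrite /s c0.
  by rewrite /s; case: (cc _ it) => ->; rewrite ?andbF.
have cs i : (i < t.-1)%N -> c i = if s i then m else 0%N.
  move=> it; have [|e|] := ext i; first by lia.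
    by rewrite /s e.
  by rewrite /s /runner_top ifN; [move->; case: ifP; lia|lia].
have [|e|e] := ext t.-1; first by lia.
- left; have [|h1 h2 h3] := @isolated_sum_max s t.-1; first by apply: isolated_leq iso; lia.
  move: h1 h2 h3 (@weight2_noend t m c s (ltnW t1) cs e).
  set k := (\sum_(i < _) (s i : nat))%N; set S := (\sum_(i < _) _)%N.
  move=> h1 h2 h3 w; exists k; first by lia.
  have [/h3 e'|ne] := eqVneq (S + k * k)%N (k * t.-1)%N; [right|left].
    move=> i it; rewrite /conf_G; case: (ltnP i t.-1) => it1 /=.
      by rewrite -e' //; exact: cs.
    by have -> : i = t.-1 by lia.
  by rewrite w gtrDl pmulr_rlt0 ?subr_lt0; lia.
- rewrite /runner_top eqxx in e; right.
  have t2 : t.-2.+1 = t.-1 by lia.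
  have e1 : c t.-2.+1 = m.-1 by rewrite t2.
  (* Since m - 1 > 0, runner t - 1 is nonempty and its neighbour is empty. *)
  have e0 : c t.-2 = 0%N by have [||] := cc t.-2; lia.
  have [|h1 h2 h3] := @isolated_sum_max s t.-2; first by apply: isolated_leq iso; lia.
  have cs2 i : (i < t.-2)%N -> c i = if s i then m else 0%N by move=> it; apply: cs; lia.
  move: h1 h2 h3 (@weight2_end t m c s t1 (ltnW m1) cs2 e0 e1).
  set k := (\sum_(i < _) (s i : nat))%N; set S := (\sum_(i < _) _)%N.
  move=> h1 h2 h3 w; exists k.+1; first by lia.
  have [/h3 e'|ne] := eqVneq (S + k * k)%N (k * t.-2)%N; [right|left].
    move=> i it; rewrite /conf_F /=; case: eqP => [->//|ne].
    case: (ltnP i t.-2) => it1 /=; first by rewrite -e' //; exact: cs2.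
    by have -> : i = t.-2 by lia.
  have -> : k.+1%:Z = k%:Z + 1 by lia.
  by rewrite w gtrDl pmulr_rlt0 ?subr_lt0; lia.
Qed.

(** * The largest size *)

Lemma F2E m t (k : int) : F m t k%:~R = (F2 t m k)%:~R / 2.
Proof.
by rewrite /F /F2 !(rmorphD, rmorphN, rmorphM, rmorphXn) /= -!pmulrn; field.
Qed.

Lemma G2E m t (k : int) : G m t k%:~R = (G2 t m k)%:~R / 2.
Proof.
by rewrite /G /G2 !(rmorphD, rmorphN, rmorphM, rmorphXn) /= -!pmulrn; field.
Qed.

Lemma F2_G2 t m k : F2 t m k = G2 t m k + 2 * m%:Z * (2 * k - t%:Z).
Proof. by rewrite /F2 /G2; ring. Qed.

(** * Concave parabolas on the integers *)

Lemma parabola_increasing (A N k k' : int) : 0 <= A -> (2 * k - 1) * A <= N ->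
  k' <= k -> k' * N - A * k' ^+ 2 <= k * N - A * k ^+ 2.
Proof.
move=> A0 h; rewrite le_eqVlt => /orP[/eqP->//|lt]; rewrite -subr_ge0.
(* For integers k' < k one has k + k' <= 2 k - 1, so the second factor is nonnegative. *)
have -> : k * N - A * k ^+ 2 - (k' * N - A * k' ^+ 2) =
  (k - k') * (N - (k + k') * A) by ring.
apply: mulr_ge0; first by lia.
by rewrite subr_ge0 (le_trans _ h) // ler_wpM2r //; lia.
Qed.

(** For A > 0 the hypothesis makes [k] a nearest integer to the vertex N / (2 A). Points to its
    right reduce to the previous lemma by negating k, k' and N. *)
Lemma parabola_max (A N k k' : int) : 0 <= A ->
  (2 * k - 1) * A <= N <= (2 * k + 1) * A ->
  k' * N - A * k' ^+ 2 <= k * N - A * k ^+ 2.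
Proof.
move=> A0 /andP[h1 h2]; have [|/ltW lt] := leP k' k.
  exact: parabola_increasing.
have := @parabola_increasing A (- N) (- k) (- k') A0.
by rewrite !mulrNN !sqrrN; apply; lia.
Qed.

Lemma parabola_tie (A N k k' : int) : k != k' ->
  k * N - A * k ^+ 2 = k' * N - A * k' ^+ 2 -> A * (k + k') = N.
Proof.
rewrite -subr_eq0 => ne e; apply/eqP; rewrite -subr_eq0 -(mulrI_eq0 _ (mulfI ne)).
apply/eqP; transitivity (k' * N - A * k' ^+ 2 - (k * N - A * k ^+ 2)); first by ring.
by rewrite e subrr.
Qed.

Lemma G2_parabola t m k :
  G2 t m k = m%:Z * (k * (m%:Z * t%:Z + t%:Z - 1) - (m%:Z + 2) * k ^+ 2).
Proof. by rewrite /G2; ring. Qed.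

Lemma F2_parabola t m k : F2 t m k =
  m%:Z * (k * (m%:Z * t%:Z + t%:Z + 3) - (m%:Z + 2) * k ^+ 2) - 2 * m%:Z * t%:Z.
Proof. by rewrite /F2; ring. Qed.

Lemma star_itv x : (star x)%:~R - 1 / 2 < x <= (star x)%:~R + 1 / 2.
Proof.
have h1 := floor_le x; have h2 := floorD1_gt x.
rewrite /star /frac_part; rewrite rmorphD /= in h2; case: ifP => h; first by lra.
by move/negbT: h; rewrite -ltNge rmorphD /= => h; lra.
Qed.

(** By [F2_parabola] and [G2_parabola], [alpha m t 3] and [alpha m t (-1)] are the vertices of [F2]
    and [G2]; this puts [star] into the form that [parabola_max] takes. *)
Lemma star_alpha m t x (k := star (alpha m t x)) :
  (2 * k - 1) * (m%:Z + 2) < m%:Z * t%:Z + t%:Z + x <= (2 * k + 1) * (m%:Z + 2).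
Proof.
have /andP[] := star_itv (alpha m t x); rewrite -/k /alpha => h1 h2.
have m0 : 0 < 2 * (m%:R + 2) :> rat by have : 0 <= m%:R :> rat by []; lra.
rewrite ltr_pdivlMr // in h1; rewrite ler_pdivrMr // in h2.
rewrite -(ler_int rat) -(ltr_int rat) !(rmorphD, rmorphN, rmorphM) /= -!pmulrn.
by apply/andP; split; lra.
Qed.

Section Largest.
Variables (t m : nat).
Hypotheses (ht : (2 <= t)%N) (hm : (2 <= m)%N).
Let P := distinct_core2 t (m * t - 1).

Definition core_G k := abacus t m (conf_G t m k).
Definition core_F k := abacus t m (conf_F t m k).
(** At 2 k = t the first family would need residue 0; the second then supplies a partition of the
    same size [G k]. *)
Definition core_max k := if (2 * k < t)%N then core_G k else core_F k.

Lemma core_GP k : (2 * k < t)%N -> P (core_G k) /\ 2 * (sumn (core_G k))%:Z = G2 t m k.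
Proof.
move=> kt; have ac : admissible t m (conf_G t m k) by apply: admissible_conf_G; lia.
split; first exact: abacus_distinct_core.
by rewrite sumn_abacus // weight2_conf_G //; lia.
Qed.

Lemma core_FP k : (0 < k)%N -> (2 * k <= t)%N ->
  P (core_F k) /\ 2 * (sumn (core_F k))%:Z = F2 t m k.
Proof.
move=> k0 kt; have ac : admissible t m (conf_F t m k) by apply: admissible_conf_F; lia.
split; first exact: abacus_distinct_core.
by rewrite sumn_abacus // weight2_conf_F //; lia.
Qed.

Lemma core_maxP k : (2 * k <= t)%N ->
  P (core_max k) /\ 2 * (sumn (core_max k))%:Z = G2 t m k.
Proof.
rewrite /core_max => kt; case: ltnP => tk; first exact: core_GP.
have [||p ->] := @core_FP k; [lia|lia|split=> //].
rewrite F2_G2; have -> : t%:Z = 2 * k%:Z by lia.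
by rewrite subrr mulr0 addr0.
Qed.

(** A member of the second family with 2 k < t falls under the strict alternative. Strictness away
    from [core_max k] later identifies all partitions of largest size. *)
Lemma distinct_core_bound la : P la ->
  exists2 k, (2 * k <= t)%N & la = core_max k \/ 2 * (sumn la)%:Z < G2 t m k.
Proof.
move=> /distinct_core_abacus[] // c ac ->.
have [c' [ac' ext imp]] := extremal_improve ht hm ac (leqnn t).
rewrite sumn_abacus //.
have t0 : (0 < t)%N by lia.
have [[k kt h]|[k /andP[k0 kt] h]] := extremal_weight ht hm ac' ext.
  exists k; first exact: ltnW.
  rewrite /core_max kt; case: h => [lt|e].
    by right; case: imp => [<- //|]; move/lt_trans; apply.
  case: imp => [<-|lt]; first by left; apply: abacus_ext.
  by right; rewrite -weight2_conf_G // -(weight2_ext e).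
have FG : F2 t m k <= G2 t m k by rewrite F2_G2; nia.
exists k => //; case: h => [lt|e].
  by right; apply: lt_le_trans FG; case: imp => [<- //|]; move/lt_trans; apply.
have w : weight2 t c' = F2 t m k by rewrite (weight2_ext e) weight2_conf_F //; lia.
case: imp => [<-|lt]; last by right; rewrite (lt_le_trans lt) // w.
rewrite /core_max; case: ltnP => k2; last by left; apply: abacus_ext.
by right; rewrite w F2_G2; nia.
Qed.

(** Sizes are bounded by [G k] with 2 k <= t; below t / 2 the maximum at [kG] dominates, and at 2 k
    = t the value equals [F k], dominated by [kF]. *)
Lemma largest_size_max (kF kG : nat) :
  (0 < kF)%N -> (2 * kF <= t)%N -> (2 * kG < t)%N ->
  (forall k : nat, F2 t m k <= F2 t m kF) ->
  (forall k : nat, (2 * k < t)%N -> G2 t m k <= G2 t m kG) ->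
  largest_size_is P (Num.max (F m t kF%:~R) (G m t kG%:~R)).
Proof.
move=> k0 kF2 kG2 hF hG; rewrite F2E G2E.
have [pF sF] := core_FP k0 kF2; have [pG sG] := core_GP kG2.
have bound mu : P mu -> 2 * (sumn mu)%:Z <= Num.max (F2 t m kF) (G2 t m kG).
  move=> /distinct_core_bound[k kt h].
  have {}h : 2 * (sumn mu)%:Z <= G2 t m k.
    by case: h => [->|/ltW//]; have [_ ->] := core_maxP kt.
  apply: le_trans h _; rewrite le_max; case: (ltnP (2 * k) t) => tk.
    by rewrite (hG k tk) orbT.
  by apply/orP; left; apply: le_trans (hF k); rewrite F2_G2; nia.
have rs la (z : int) : 2 * (sumn la)%:Z = z -> (sumn la)%:R = z%:~R / 2 :> rat.
  by move=> <-; rewrite rmorphM /= -pmulrn; field.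
have [le|lt] := leP (F2 t m kF) (G2 t m kG).
- exists (core_G kG); split.
    split=> // mu /bound; rewrite max_r // -sG; lia.
  by rewrite max_r ?(rs _ _ sG) // ler_pM2r // ler_int.
- exists (core_F kF); split.
    split=> // mu /bound; rewrite (max_l (ltW lt)) -sF; lia.
  by rewrite max_l ?(rs _ _ sF) // ler_pM2r // ler_int ltW.
Qed.

(** Equal values are symmetric about the vertex, so a + b = b + c. *)
Lemma G2_tie (a b c : nat) : (a < b)%N -> (b < c)%N ->
  G2 t m a = G2 t m b -> G2 t m b = G2 t m c -> False.
Proof.
move=> ab bc; rewrite !G2_parabola.
have mi : injective ( *%R m%:Z) by apply: mulfI; lia.
move=> /mi e1 /mi e2.
have := parabola_tie _ e1; have := parabola_tie _ e2; nia.
Qed.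

Lemma card_largest : card_at_most (has_largest_size P) 2.
Proof.
pose r := iota 0 t./2.+1.
(* The maximizers of [G2] on 0, ..., t / 2, in increasing order; three of them would contradict
   [G2_tie]. *)
pose ks := [seq k : nat <- r | all (fun j : nat => G2 t m j <= G2 t m k%:Z) r].
have rP k : (k \in r) = (2 * k <= t)%N by rewrite mem_iota; lia.
have ksP k : reflect ((2 * k <= t)%N /\
    forall j : nat, (2 * j <= t)%N -> G2 t m j <= G2 t m k) (k \in ks).
  rewrite mem_filter rP; apply: (iffP andP) => [[/allP h kt]|[kt h]]; split=> //.
    by move=> j jt; apply: h; rewrite rP.
  by apply/allP => j; rewrite rP; exact: h.
exists (undup (map core_max ks)); split.
- exact: undup_uniq.
- move=> la; rewrite mem_undup; split.
    case/mapP => k /ksP[kt h] ->; have [p s] := core_maxP kt.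
    split=> // mu /distinct_core_bound[j jt hj]; have := h j jt.
    case: hj => [->|]; last by lia.
    by have [_ sj] := core_maxP jt; lia.
  case=> p h; have [k kt [e|lt]] := distinct_core_bound p; last first.
    by have [/h pk sk] := core_maxP kt; lia.
  rewrite e; apply: map_f; apply/ksP; split=> // j jt.
  have [/h pj <-] := core_maxP jt; have [_ <-] := core_maxP kt.
  by rewrite -e; lia.
- apply: leq_trans (size_undup _) _; rewrite size_map.
  have : sorted ltn ks by apply: sorted_filter; [exact: ltn_trans|exact: iota_ltn_sorted].
  have eqG a b : a \in ks -> b \in ks -> G2 t m a = G2 t m b.
    by move=> /ksP[ha a'] /ksP[hb b']; apply: le_anti; rewrite a' ?b'.
  case: ks {ksP} eqG => [|a [|b [|c s]]] //= eqG /and3P[ab bc _].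
  by case: (@G2_tie a b c) => //; apply: eqG; rewrite !inE eqxx ?orbT.
Qed.

(** The rounded vertex of [F2] always lands in the range where [core_F] exists. *)
Lemma star_F : exists kF : nat, [/\ star (alpha m t 3) = kF%:Z, (0 < kF)%N,
  (2 * kF <= t)%N & forall k : nat, F2 t m k <= F2 t m kF].
Proof.
have := star_alpha m t 3; set k := star _ => h; exists `|k|%N.
have kp : 0 < k by nia.
rewrite gez0_abs ?ltW //; split=> //; [lia|nia|move=> k'].
by rewrite !F2_parabola lerD2r ler_wpM2l //; apply: parabola_max; lia.
Qed.

Lemma largest_size_large :
  (odd t /\ (m + 1 < t)%N) \/ (~~ odd t /\ (2 * m + 3 < t)%N) ->
  largest_size_is P (Num.max (F m t (star (alpha m t 3))%:~R)
                             (G m t (star (alpha m t (-1)))%:~R)).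
Proof.
have [kF [-> kF0 kFt hF]] := star_F => hyp.
have := star_alpha m t (-1); set k := star _ => h.
have kp : 0 <= k by nia.
have [kG ekG] : exists kG : nat, k = kG%:Z by exists `|k|%N; lia.
(* The rounded vertex must satisfy 2 kG < t; for even t, 2 kG = t would give t < m + 1. *)
rewrite ekG in h *; apply: largest_size_max => //; first by case: hyp => -[]; nia.
by move=> k' _; rewrite !G2_parabola ler_wpM2l //; apply: parabola_max; lia.
Qed.

Lemma floor_half (n : nat) : (0 < n)%N ->
  Num.floor ((n%:R - 1) / 2 : rat) = (n.-1./2)%:Z.
Proof.
move=> n0; apply: floor_def; rewrite ler_pdivlMr // ltr_pdivrMr //.
have -> : n%:R - 1 = (n%:Z - 1)%:~R :> rat by rewrite rmorphB.
by rewrite -[2](_ : 2%:~R = _ :> rat) // -!rmorphM /= ler_int ltr_int; lia.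
Qed.

Lemma largest_size_small :
  (odd t /\ (t <= m + 1)%N) \/ (~~ odd t /\ (t <= 2 * m + 3)%N) ->
  largest_size_is P (Num.max (F m t (star (alpha m t 3))%:~R)
                      (G m t (Num.floor ((t%:R - 1) / 2 : rat))%:~R)).
Proof.
have [kF [-> kF0 kFt hF]] := star_F => hyp.
rewrite floor_half; last by lia.
apply: largest_size_max => //; first by lia.
move=> k kt; rewrite !G2_parabola ler_wpM2l //.
apply: parabola_increasing => //; last by lia.
(* With kG the largest k such that 2 k < t, [G2] increases up to kG if t <= 2 m + 3 for odd t, or t
   <= 3 m + 5 for even t; both follow from [hyp]. *)
by case: hyp => -[]; nia.
Qed.

End Largest.

Local Close Scope ring_scope.

Theorem theorem1p2 (t m : nat) (ht : 2 <= t) (hm : 2 <= m) :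
  let P := distinct_core2 t (m * t - 1) in
  let a := alpha m t 3 in
  let b := alpha m t (-1)%R in
  [/\ (odd t /\ m + 1 < t) \/ (~~ odd t /\ 2 * m + 3 < t) ->
        largest_size_is P
          (Num.max (F m t (star a)%:~R) (G m t (star b)%:~R))%R,
      (odd t /\ t <= m + 1) \/ (~~ odd t /\ t <= 2 * m + 3) ->
        largest_size_is P
          (Num.max (F m t (star a)%:~R)
                   (G m t (Num.floor ((t%:R - 1) / 2 : rat))%:~R))%R
    & card_at_most (has_largest_size P) 2].
Proof.
move=> P a b; split.
- exact: largest_size_large.
- exact: largest_size_small.
- exact: card_largest.
Qed.
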